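(* For an acyclic mixed graph $G=(V,D,B)$ with $V=[m]$, let $$\phi_G:\mathbb{R}^D\times \mathit{PD}(B)\to \mathit{PD}(m),\qquad \phi_G(\Lambda,\Omega)=(I-\Lambda)^{-T}\,\Omega\,(I-\Lambda)^{-1}.$$ If $G$ has at most three nodes, then $\phi_G$ is injective if and only if $G$ is simple. Furthermore, there are exactly two unlabeled (i.e., up to isomorphism of mixed graphs) simple acyclic mixed graphs $G$ on four nodes for which $\phi_G$ is not injective.
   Context: A mixed graph is a triple $G=(V,D,B)$ with $V$ a finite node set, here $V=[m]:=\{1,\dots,m\}$, and $D,B\subseteq V\times V$. Elements $(i,j)\in D$ are directed edges $i\to j$. $B$ is symmetric, and its elements are bidirected edges $i\leftrightarrow j$. There are no self-loops. $G$ is acyclic if $(V,D)$ has no directed cycles. An acyclic mixed graph is simple if there is at most one edge between any pair of nodes, i.e., $D\cap B=\varnothing$. Isomorphism of mixed graphs means a bijection of node sets preserving directed edges (with direction) and bidirected edges. $\mathbb{R}^D$ is the set of real $m\times m$ matrices $\Lambda=(\lambda_{ij})$ with $\lambda_{ij}=0$ whenever $(i,j)\notin D$; for acyclic $G$, $I-\Lambda$ is invertible for all $\Lambda\in\mathbb{R}^D$. $\mathit{PD}(m)$ is the cone of real symmetric positive definite $m\times m$ matrices; $\mathit{PD}(B)$ is the set of $\Omega=(\omega_{ij})\in \mathit{PD}(m)$ with $\omega_{ij}=0$ whenever $i\neq j$ and $(i,j)\notin B$. $M^{-T}$ denotes the transpose of $M^{-1}$. *)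

(* Defs.v *)
From HB Require Import structures.
From mathcomp Require Import all_boot all_order all_algebra.
From mathcomp Require Import boolp classical_sets functions reals.

Set Implicit Arguments.
Unset Strict Implicit.
Unset Printing Implicit Defensive.

Import Order.TTheory GRing.Theory Num.Theory.

Local Open Scope classical_set_scope.
Local Open Scope ring_scope.

(* The node set [m] is 'I_m.  A bidirected edge i <-> j is encoded by both
   ordered pairs (i, j) and (j, i). *)
Record mixed_graph (m : nat) := MixedGraph {
  directed : {set 'I_m * 'I_m};
  bidirected : {set 'I_m * 'I_m};
  directed_irr : forall i, (i, i) \notin directed;
  bidirected_irr : forall i, (i, i) \notin bidirected;
  bidirected_sym : forall i j,
    ((i, j) \in bidirected) = ((j, i) \in bidirected)
}.

Definition dedge m (G : mixed_graph m) : rel 'I_m :=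
  fun i j => (i, j) \in directed G.

(* The library's cycles may be empty, hence the conclusion [c = [::]]. *)
Definition acyclic m (G : mixed_graph m) : Prop :=
  forall c : seq 'I_m, ucycle (dedge G) c -> c = [::].

(* For acyclic [G], i.e. when (i, j) and (j, i) are never both directed edges,
   this says that any pair of nodes carries at most one edge. *)
Definition simple m (G : mixed_graph m) : Prop :=
  directed G :&: bidirected G = finset.set0.

Definition isomorphic m n (G : mixed_graph m) (H : mixed_graph n) : Prop :=
  exists f : 'I_m -> 'I_n,
    [/\ bijective f,
        forall i j, ((i, j) \in directed G) = ((f i, f j) \in directed H)
      & forall i j, ((i, j) \in bidirected G) = ((f i, f j) \in bidirected H)].

Definition RD (R : realType) m (G : mixed_graph m) : set 'M[R]_m :=
  [set L | forall i j, (i, j) \notin directed G -> L i j = 0].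
Arguments RD R {m} G _.

Definition PD (R : realType) m : set 'M[R]_m :=
  [set A | A^T = A /\
           forall x : 'cV[R]_m, x != 0 -> 0 < (x^T *m A *m x) ord0 ord0].
Arguments PD R m _ : clear implicits.

Definition PDB (R : realType) m (G : mixed_graph m) : set 'M[R]_m :=
  [set W | PD R m W /\
           forall i j, i != j -> (i, j) \notin bidirected G -> W i j = 0].
Arguments PDB R {m} G _.

(* The domain of the parametrization. *)
Definition Theta (R : realType) m (G : mixed_graph m) :
    set ('M[R]_m * 'M[R]_m) :=
  RD R G `*` PDB R G.
Arguments Theta R {m} G _.

(* [invmx] is a total function; it is the genuine inverse here because
   [1 - Lambda] is invertible when [G] is acyclic (lemma [unitmx_1B]), and
   [phi] then maps [Theta R G] into [PD R m] (lemma [phi_fun]). *)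
Definition phi (R : realType) m (p : 'M[R]_m * 'M[R]_m) : 'M[R]_m :=
  (invmx (1%:M - p.1))^T *m p.2 *m invmx (1%:M - p.1).

Lemma path_traject (T : Type) (e : rel T) (f : T -> T) x n :
  (forall i, e (iter i f x) (iter i.+1 f x)) -> path e x (traject f (f x) n).
Proof.
elim: n x => //= n IHn x st; rewrite (st 0%N) /=.
by apply: IHn => i; have := st i.+1; rewrite -!iterSr.
Qed.

Lemma unitmx_1B (R : realType) m (G : mixed_graph m) (L : 'M[R]_m) :
  acyclic G -> RD R G L -> 1%:M - L \in unitmx.
Proof.
move=> acG LD; apply: contrapT => /negP nu.
have : \det (1%:M - L)^T == 0 by rewrite det_tr -[_ == 0]negbK -unitfE.
case/det0P => v v0 /(congr1 trmx).
rewrite trmx_mul trmxK trmx0 mulmxBl mul1mx => /subr0_eq vE.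
have succ i : v 0 i != 0 -> exists j, ((i, j) \in directed G) && (v 0 j != 0).
  move=> vi; apply: contrapT => H; move/negP: vi; apply; apply/eqP.
  have -> : v 0 i = v^T i 0 by rewrite mxE.
  rewrite vE mxE big1 // => j _; rewrite [v^T _ _]mxE.
  have [/LD ->|ij] := boolP ((i, j) \notin directed G); first by rewrite mul0r.
  have [->|vj] := eqVneq (v 0 j) 0; first by rewrite mulr0.
  by case: H; exists j; rewrite -[X in X && _]negbK ij.
pose f i := odflt i [pick j | ((i, j) \in directed G) && (v 0 j != 0)].
have fP i : v 0 i != 0 -> ((i, f i) \in directed G) && (v 0 (f i) != 0).
  rewrite /f => /succ [j jP]; case: pickP => [//|/(_ j)].
  by rewrite jP.
have [x vx] : exists x, v 0 x != 0.
  by apply/rV0Pn.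
have vit k : v 0 (iter k f x) != 0 by elim: k => //= k /fP /andP[].
have /trajectP[k kn itE] := looping_order f x.
pose y := iter k f x; pose d := (order f x - k)%N.
have dgt : (0 < d)%N by rewrite subn_gt0.
have ity : iter d f y = y by rewrite -iterD subnK 1?ltnW.
have : traject f y d = [::].
  apply: acG; rewrite /ucycle; apply/andP; split; last first.
    have : uniq (traject f x (order f x)) by apply: orbit_uniq.
    by rewrite -(subnKC (ltnW kn)) trajectD cat_uniq => /and3P[].
  case: d dgt ity => // d _ ity; rewrite /= rcons_path last_traject.
  have st i : dedge G (iter i f y) (iter i.+1 f y).
    by rewrite -!iterD iterD /=; case/andP: (fP _ (vit (i + k)%N)); rewrite iterD.
  apply/andP; split; last by have := st d; rewrite ity.
  exact: path_traject.
by case: d dgt {ity}.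
Qed.

Lemma phi_fun (R : realType) m (G : mixed_graph m) :
  acyclic G -> set_fun (Theta R G) (PD R m) (@phi R m).
Proof.
move=> acG [L W] [/= LD [[Ws Wp] _]]; have u := unitmx_1B acG LD.
rewrite /phi /=; set A := invmx _; split.
  by rewrite !trmx_mul trmxK Ws mulmxA.
move=> x x0; have := Wp (A *m x); rewrite trmx_mul !mulmxA; apply.
apply: contra x0 => /eqP /(congr1 (mulmx (1%:M - L))).
by rewrite mulmxA mulmxV // mul1mx mulmx0 => ->.
Qed.

(* Main.v *)
Require Import Defs.
From mathcomp Require Import all_boot all_order all_algebra.
From mathcomp Require Import boolp classical_sets functions reals.
From mathcomp Require Import ring lra.

(* Suppose two parameters [(L, W)] and [(L', W')] have the same image, and let
   [j] be a node of minimal rank in a topological order where the columns of [L]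
   and [L'] differ.  Put [x = L e_j - L' e_j], which is supported on the parents
   of [j], and [y = (1 - L)^-1 x].  Comparing the columns [j] of [W] and [W']
   gives [(W y)_v = 0] at every node [v] before [j] without edge [v <-> j].  Let
   [Y] be the support of [y].  Each node of [Y] has a directed edge into
   [Y + j], because [y = x + L y]; and no part of [Y] is cut off from the rest
   of [Y + j] in the bidirected graph, because [W] is positive definite.  In a
   simple graph this requires [2 |Y|] edges between the [|Y| + 1] nodes of
   [Y + j], hence [|Y| >= 3]; for [|Y| = 3] the directed and the bidirected
   edges form two complementary spanning paths of K4, and the directed one is
   [0 -> 1 -> 2 -> 3] or [0 -> 1 -> 3 <- 2].  Conversely a vector [y] with these
   properties yields a second point of the fiber of [(L, W)]. *)

Set Implicit Arguments.
Unset Strict Implicit.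
Unset Printing Implicit Defensive.

Import Order.TTheory GRing.Theory Num.Theory.
Local Open Scope ring_scope.

(** * Acyclicity and topological ranks *)

Lemma acyclic_ranked m (G : mixed_graph m) (rank : 'I_m -> nat) :
  (forall i j, (i, j) \in directed G -> (rank i < rank j)%N) -> acyclic G.
Proof.
move=> rk [//|i c] /andP[/= cyc _].
have : path ltn (rank i) (map rank (rcons c i)).
  by rewrite path_map; apply: sub_path cyc => u v /rk.
move/(order_path_min ltn_trans)/allP/(_ (rank i)).
by rewrite map_rcons mem_rcons mem_head /= ltnn => /(_ isT).
Qed.

Lemma acyclic_rank m (G : mixed_graph m) : acyclic G ->
  {rank : 'I_m -> nat |
    forall i j, (i, j) \in directed G -> (rank i < rank j)%N}.
Proof.
(* The rank of [j] counts its ancestors, [j] included. It grows strictly along [i -> j] because [j]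
   is not an ancestor of [i]: a simple path from [j] to [i] would close up to a cycle. *)
move=> acG; exists (fun j => #|[set i | connect (dedge G) i j]|) => i j ij.
have con_ij : connect (dedge G) i j by apply: connect1.
apply/proper_card/properP; split.
  by apply/fintype.subsetP => k; rewrite !inE => /connect_trans; apply.
exists j; rewrite !inE ?connect0 //; apply/negP => /connectP[p jp iE].
case: (shortenP jp) iE => q jq uq _ iE.
have // : j :: q = [::].
by apply: acG; rewrite /ucycle uq /= rcons_path jq -iE /dedge ij.
Qed.

(** * From two points of a fiber to a configuration of edges *)

Lemma unit_inj (R : realType) m (A : 'M[R]_m) (x : 'cV[R]_m) :
  A \in unitmx -> A *m x = 0 -> x = 0.
Proof. by move=> uA /(congr1 (mulmx (invmx A))); rewrite mulKmx ?mulmx0. Qed.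

Lemma phiK (R : realType) m (L W : 'M[R]_m) : 1%:M - L \in unitmx ->
  (1%:M - L)^T *m phi (L, W) *m (1%:M - L) = W.
Proof.
move=> u; rewrite /phi /= -!mulmxA mulVmx // mulmx1 !mulmxA.
by rewrite -trmx_mul mulVmx // trmx1 mul1mx.
Qed.

(* Since [W] has no entries between [K] and the rest of the support of [y],
   the restriction [z] of [y] to [K] satisfies [z^T W z = z^T W y = 0]. *)
Lemma PD_support_edge (R : realType) m (W : 'M[R]_m) (y : 'cV[R]_m)
    (K : {set 'I_m}) :
  PD R m W -> K != finset.set0 -> (forall i, i \in K -> y i 0 != 0) ->
  (forall i, i \in K -> (W *m y) i 0 = 0) ->
  exists u v, [/\ u \in K, v \notin K, y v 0 != 0 & W u v != 0].
Proof.
move=> [_ Wpos] /set0Pn[i0 i0K] yK WyK; apply: contrapT => H.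
pose z : 'cV[R]_m := \col_i (if i \in K then y i 0 else 0).
have z0 : z != 0.
  apply: contra (yK _ i0K) => /eqP /matrixP/(_ i0 0).
  by rewrite !mxE i0K => ->.
have := Wpos z z0; rewrite -mulmxA mxE big1 ?ltxx // => i _.
rewrite [z^T _ _]mxE [z i _]mxE.
case: ifPn => iK; last by rewrite mul0r.
suff -> : (W *m z) i 0 = (W *m y) i 0 by rewrite WyK ?mulr0.
rewrite !mxE; apply: eq_bigr => k _; rewrite mxE.
case: ifPn => // kK; have [->|yk] := eqVneq (y k 0) 0; first by rewrite !mulr0.
have [->|Wik] := eqVneq (W i k) 0; first by rewrite !mul0r.
by case: H; exists i, k.
Qed.

Lemma not_inj_converging_connected (R : realType) m (G : mixed_graph m) :
  acyclic G -> ~ set_inj (Theta R G) (@phi R m) ->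
  exists (j : 'I_m) (Y : {set 'I_m}),
  [/\ Y != finset.set0, j \notin Y,
      forall i, i \in Y -> exists2 k, k \in j |: Y & (i, k) \in directed G
    & forall K : {set 'I_m}, K != finset.set0 -> K \subset Y ->
      exists u v,
        [/\ u \in K, v \in j |: Y, v \notin K & (u, v) \in bidirected G]].
Proof.
move=> acG ninj.
have [rank rkP] := acyclic_rank acG.
(* By [phiK], the image and [L] determine [W], so distinct parameters in one fiber already differ in
   [L]. *)
have [L [W [L' [W' [LD LD' WB WB' [SE LL']]]]]] :
    exists L W L' W', [/\ RD R G L, RD R G L', PDB R G W, PDB R G W'
      & phi (L, W) = phi (L', W') /\ L != L'].
  apply: contrapT => H; apply: ninj => -[L W] [L' W'].
  rewrite !inE => -[/= LD WB] [/= LD' WB'] SE.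
  have [LL'|LL'] := eqVneq L L'; last by case: H; exists L, W, L', W'.
  congr pair => //.
  rewrite -(phiK W (unitmx_1B acG LD)) -(phiK W' (unitmx_1B acG LD')).
  by rewrite SE LL'.
have uL := unitmx_1B acG LD; have uL' := unitmx_1B acG LD'.
have [j0 j0P] : exists j, col j L != col j L'.
  apply: contrapT => H; move/eqP: LL'; apply; apply/matrixP => i j.
  have [/colP/(_ i)|] := eqVneq (col j L) (col j L'); first by rewrite !mxE.
  by move=> jP; case: H; exists j.
case: (@arg_minnP _ j0 (fun j => col j L != col j L') rank j0P) => j jP jmin.
pose N := 1%:M - L; pose N' := 1%:M - L'.
pose x := col j L - col j L'.
have x0 : x != 0 by rewrite subr_eq0.
have xE : x = col j N' - col j N.
  by apply/colP => i; rewrite !mxE opprB [RHS]addrC addrA subrK.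
pose y := invmx N *m x.
have Ny : N *m y = x by rewrite mulKVmx.
have xP i : x i 0 != 0 -> (i, j) \in directed G.
  by move=> xi; apply: contraNT xi => ij; rewrite !mxE LD ?LD' // subr0.
have yP i : y i 0 != 0 ->
    (i, j) \in directed G \/ exists2 k, y k 0 != 0 & (i, k) \in directed G.
  move=> yi; have [xi|/xP] := eqVneq (x i 0) 0; last by left.
  right; apply: contrapT => H; move/negP: yi; apply; apply/eqP.
  have -> : y = x + L *m y by rewrite -Ny mulmxBl mul1mx subrK.
  rewrite mxE xi add0r mxE big1 // => k _.
  have [->|yk] := eqVneq (y k 0) 0; first by rewrite mulr0.
  have [ik|/LD ->] := boolP ((i, k) \in directed G); last by rewrite mul0r.
  by case: H; exists k.
(* A node of maximal rank in the support of [y] has no child in that support, so it is a parent of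
   [j]; hence the whole support ranks below [j]. *)
have yrk i : y i 0 != 0 -> (rank i < rank j)%N.
  move=> yi; case: (@arg_maxnP _ i (fun k => y k 0 != 0) rank yi) =>
    k /yP kP kmax.
  apply: leq_ltn_trans (kmax i yi) _.
  case: kP => [/rkP//|[l yl /rkP kl]].
  by have := leq_trans kl (kmax l yl); rewrite ltnn.
have Wy v : y v 0 != 0 -> (v, j) \notin bidirected G -> (W *m y) v 0 = 0.
  move=> /yrk vj vjB.
  have vNj : v != j by apply: contraTneq vj => ->; rewrite ltnn.
  have colv z : (N'^T *m z) v 0 = (N^T *m z) v 0 :> R.
    have : col v L = col v L'.
      by apply/eqP; apply: contraTT vj => /jmin; rewrite -leqNgt.
    move=> /colP E; rewrite !mxE; apply: eq_bigr => i _.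
    by have := E i; rewrite !mxE => ->.
  set S := phi (L, W) in SE.
  have WE : col j W = N^T *m (S *m col j N).
    by rewrite -[in LHS](phiK W uL) !colE !mulmxA.
  have WE' : col j W' = N'^T *m (S *m col j N').
    by rewrite -[in LHS](phiK W' uL') -SE !colE !mulmxA.
  (* As columns [v] of [N] and [N'] agree, the difference is entry [v] of
     [N^T S (N' - N) e_j = N^T S x = N^T S N y]. *)
  have : W' v j - W v j = (W *m y) v 0.
    have -> : W' v j = col j W' v 0 by rewrite mxE.
    have -> : W v j = col j W v 0 by rewrite mxE.
    rewrite WE WE' colv -[W in RHS](phiK W uL) -/N -/S -!mulmxA Ny xE.
    by rewrite !mulmxBr [RHS]mxE; congr (_ + _); rewrite [RHS]mxE.
  by move<-; rewrite WB.2 // WB'.2 // subrr.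
exists j, [set i | y i 0 != 0]; split.
- apply/set0Pn; have [i yi] : exists i, y i 0 != 0.
    apply: contrapT => H; move/eqP: x0; apply; rewrite -Ny.
    rewrite (_ : y = 0) ?mulmx0 //; apply/colP => i; rewrite [RHS]mxE.
    by apply/eqP; apply: contrapT => /negP yi; case: H; exists i.
  by exists i; rewrite inE.
- by rewrite inE; apply/negP => /yrk; rewrite ltnn.
- move=> i; rewrite inE => /yP[ij|[k yk ik]].
    by exists j; rewrite ?setU11.
  by exists k; rewrite // !inE yk orbT.
move=> K K0 /fintype.subsetP KY; apply: contrapT => H.
have KyP i : i \in K -> y i 0 != 0 by move/KY; rewrite inE.
have [|u [v [uK vK yv Wuv]]] := PD_support_edge WB.1 K0 KyP.
  move=> i iK; apply: (Wy _ (KyP _ iK)); apply/negP => ij; case: H.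
  exists i, j; rewrite setU11; split=> //.
  by apply/negP => /KyP/yrk; rewrite ltnn.
case: H; exists u, v; rewrite !inE yv orbT; split=> //.
apply: contraNT Wuv => uv; rewrite WB.2 //.
by apply: contraNneq vK => <-.
Qed.

(** * Constructing a second point of a fiber *)

(** With [x = (1 - L) y], the condition on [x] preserves the required zeros of [L] when [x] is added
    to its column [j]; the one on [W y] preserves those of [W] under the change that the fiber then
    forces. *)
Definition fiber_direction (R : realType) m (G : mixed_graph m) (j : 'I_m)
    (L W : 'M[R]_m) (y : 'cV[R]_m) : Prop :=
  [/\ RD R G L, PDB R G W, (1%:M - L) *m y != 0,
      forall i, (i, j) \notin directed G -> ((1%:M - L) *m y) i 0 = 0
    & forall v, v != j -> (v, j) \notin bidirected G -> (W *m y) v 0 = 0].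

Lemma phiKV (R : realType) m (L S : 'M[R]_m) : 1%:M - L \in unitmx ->
  phi (L, (1%:M - L)^T *m S *m (1%:M - L)) = S.
Proof.
move=> u; rewrite /phi /= -!mulmxA mulmxV // mulmx1 !mulmxA.
by rewrite -trmx_mul mulmxV // trmx1 mul1mx.
Qed.

Lemma PD_sym (R : realType) m (W : 'M[R]_m) i j : PD R m W -> W i j = W j i.
Proof. by case=> [Ws _]; rewrite -[in LHS]Ws mxE. Qed.

Lemma PD_congr (R : realType) m (A S : 'M[R]_m) :
  A \in unitmx -> PD R m S -> PD R m (A^T *m S *m A).
Proof.
move=> u [Ss Sp]; split=> [|x x0]; first by rewrite !trmx_mul trmxK Ss mulmxA.
have := Sp (A *m x); rewrite trmx_mul !mulmxA; apply.
by apply: contra x0 => /eqP /(unit_inj u) ->.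
Qed.

(* Adding [(1 - L) y] to column [j] of [L] replaces [W] by [M^T W M] with
   [M = 1 - y e_j^T], which only affects row and column [j]. *)
Lemma fiber_direction_not_inj (R : realType) m (G : mixed_graph m) j
    (L W : 'M[R]_m) (y : 'cV[R]_m) :
  acyclic G -> fiber_direction G j L W y ->
  ~ set_inj (Theta R G) (@phi R m).
Proof.
move=> acG [LD WB x0 xP yW] inj.
set x := (1%:M - L) *m y in x0 xP.
have colE0 (z : 'cV[R]_m) u v :
    (z *m delta_mx 0 j) u v = z u 0 * (v == j)%:R :> R.
  by rewrite mxE big_ord1 !mxE eqxx.
pose M : 'M[R]_m := 1%:M - y *m delta_mx 0 j.
pose L' := L + x *m delta_mx 0 j.
have LM : (1%:M - L) *m M = 1%:M - L'.
  by rewrite mulmxBr mulmx1 mulmxA -/x /L' opprD addrA.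
have LD' : RD R G L'.
  move=> u v uv; rewrite mxE LD // add0r colE0.
  by case: eqVneq uv => [-> /xP->|_ _]; rewrite ?mul0r ?mulr0.
have u := unitmx_1B acG LD; have u' := unitmx_1B acG LD'.
pose S := phi (L, W); pose W' := (1%:M - L')^T *m S *m (1%:M - L').
have WE : W' = M^T *m (W *m M).
  by rewrite -[in RHS](phiK W u) -/S /W' -LM trmx_mul !mulmxA.
have PDW' : PD R m W'.
  apply: (PD_congr u'); apply: (phi_fun acG).
  by split.
have WB' : PDB R G W'.
  (* By symmetry of [W'] it is enough to treat rows other than [j], on which left multiplication by
     [M^T] acts as the identity. *)
  split=> // a b; wlog aj : a b / a != j => [th|] ab abB.
    have [aj|/th] := eqVneq a j; last exact.
    rewrite (PD_sym _ _ PDW'); apply: th.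
    - by rewrite -aj eq_sym.
    - by rewrite eq_sym.
    - by rewrite -bidirected_sym.
  rewrite WE; have MZ (Z : 'M[R]_m) : (M^T *m Z) a b = Z a b.
    rewrite /M raddfB /= trmx1 trmx_mul trmx_delta mulmxBl mul1mx -mulmxA.
    by rewrite !mxE big_ord1 !mxE (negPf aj) mul0r subr0.
  rewrite MZ mulmxBr mulmx1 mulmxA.
  have -> (A B : 'M[R]_m) : (A - B) a b = A a b - B a b by rewrite !mxE.
  rewrite WB.2 // colE0 sub0r.
  by case: eqVneq abB => [-> /yW->|]; rewrite ?mul0r ?mulr0 ?oppr0.
have /inj : (L, W) \in Theta R G by rewrite inE.
have in' : (L', W') \in Theta R G by rewrite inE.
move=> /(_ _ in'); rewrite phiKV // => /(_ erefl) [LL' _].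
move/eqP: x0; apply; apply/colP => i; have /matrixP/(_ i j) := LL'.
rewrite [RHS]mxE colE0 eqxx mulr1 -[X in X = _]addr0 => /addrI <-.
by rewrite mxE.
Qed.

(** * Saturated graphs and transport along isomorphisms *)

(** Both exceptional graphs on four nodes have this form, so each is given by its directed edges
    alone. *)
Definition saturation m (D : {set 'I_m * 'I_m})
    (Dirr : forall i, (i, i) \notin D) : mixed_graph m.
Proof.
apply: (@MixedGraph m D
  [set e | [&& e.1 != e.2, e \notin D & (e.2, e.1) \notin D]] Dirr).
  by move=> i; rewrite inE eqxx.
by move=> i j; rewrite !inE /= eq_sym; congr (_ && _); rewrite andbC.
Defined.

Lemma saturation_simple m (D : {set 'I_m * 'I_m})
    (Dirr : forall i, (i, i) \notin D) : simple (saturation Dirr).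
Proof.
apply/eqP; rewrite -finset.subset0; apply/fintype.subsetP => -[i j].
by rewrite !inE /= => /andP[->]; rewrite andbF.
Qed.

Lemma isomorphic_sym m n (G : mixed_graph m) (H : mixed_graph n) :
  isomorphic G H -> isomorphic H G.
Proof.
move=> [f [[g fK gK] fD fB]]; exists g; split; first by exists f.
  by move=> i j; rewrite fD !gK.
by move=> i j; rewrite fB !gK.
Qed.

Lemma simple_disjoint m (G : mixed_graph m) i j :
  simple G -> (i, j) \in directed G -> (i, j) \notin bidirected G.
Proof.
by move=> /setP/(_ (i, j)); rewrite !inE => E ij; move: E; rewrite ij /= => ->.
Qed.

Lemma simple_isomorphic m n (G : mixed_graph m) (H : mixed_graph n) :
  isomorphic G H -> simple H -> simple G.
Proof.
move=> [f [_ fD fB]] sH; apply/setP => -[i j]; rewrite !inE fD fB.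
by apply/negP => /andP[/(simple_disjoint sH)/negP].
Qed.

Lemma acyclic_isomorphic m n (G : mixed_graph m) (H : mixed_graph n) :
  isomorphic G H -> acyclic H -> acyclic G.
Proof.
move=> [f [_ fD _]] /acyclic_rank[rank rkP].
by apply: (@acyclic_ranked _ _ (rank \o f)) => i j; rewrite fD => /rkP.
Qed.

(** One inclusion per kind of edge is enough: they already put an edge on every pair of nodes, and a
    further edge of [G] would violate simplicity or acyclicity. *)
Lemma isomorphic_saturation m (G : mixed_graph m) (D : {set 'I_m * 'I_m})
    (Dirr : forall i, (i, i) \notin D) (g : 'I_m -> 'I_m) :
  acyclic G -> simple G -> injective g ->
  (forall i j, (i, j) \in D -> (g i, g j) \in directed G) ->
  (forall i j, i != j -> (i, j) \notin D -> (j, i) \notin D ->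
     (g i, g j) \in bidirected G) ->
  isomorphic G (saturation Dirr).
Proof.
move=> /acyclic_rank[rank rkP] sG ginj gD gB; apply: isomorphic_sym.
exists g; split; first exact: injF_bij.
  move=> i j /=; apply/idP/idP => [/gD//|ij]; apply: contraTT (ij) => ijD.
  have [ji|jiD] := boolP ((j, i) \in D).
    by apply/negP => /rkP; rewrite ltnNge ltnW ?rkP ?gD.
  have [->|iNj] := eqVneq i j; first exact: directed_irr.
  by apply: contraL (gB i j iNj ijD jiD); exact: simple_disjoint.
move=> i j; rewrite inE /=; apply/idP/idP => [/and3P[]|ij]; first exact: gB.
apply/and3P; split.
- by apply: contraTneq ij => ->; exact: bidirected_irr.
- by apply: contraTN ij => /gD; exact: simple_disjoint.
- rewrite bidirected_sym in ij.
  by apply: contraTN ij => /gD; exact: simple_disjoint.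
Qed.

(** Relabelling along [f] carries witnesses found on two concrete graphs over to their whole
    isomorphism classes. *)
Lemma fiber_direction_isomorphic (R : realType) m n (G : mixed_graph m)
    (H : mixed_graph n) j (L W : 'M[R]_n) y :
  isomorphic G H -> fiber_direction H j L W y ->
  exists j' L' W' y', @fiber_direction R m G j' L' W' y'.
Proof.
move=> [f [fbij fD fB]] [LD [[Ws Wp] WB] x0 xP yW].
have [g fK gK] := fbij; have finj := bij_inj fbij.
have mulE (A : 'M[R]_n) (z : 'cV[R]_n) :
    mxsub f f A *m rowsub f z = rowsub f (A *m z).
  apply/colP => i; rewrite !mxE (reindex f) /=; last by exists g => k _.
  by apply: eq_bigr => k _; rewrite !mxE.
have xE : (1%:M - mxsub f f L) *m rowsub f y = rowsub f ((1%:M - L) *m y).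
  rewrite -mulE; congr (_ *m _); apply/matrixP => a b.
  by rewrite !mxE (inj_eq finj).
exists (g j), (mxsub f f L), (mxsub f f W), (rowsub f y); split.
- by move=> a b ab; rewrite mxE LD // -fD.
- split; first split.
  + by apply/matrixP => a b; rewrite !mxE -[in LHS]Ws mxE.
  + move=> z z0; have zE : z = rowsub f (rowsub g z).
      by apply/colP => i; rewrite !mxE fK.
    have := Wp (rowsub g z); rewrite -mulmxA.
    rewrite (_ : (_ *m (W *m _)) _ _ = (z^T *m mxsub f f W *m z) 0 0).
      apply; apply: contra z0 => /eqP z0.
      by rewrite zE z0; apply/eqP/colP => i; rewrite !mxE.
    rewrite -mulmxA [in RHS]zE mulE !mxE.
    rewrite (reindex f) /=; last by exists g => k _.
    by apply: eq_bigr => k _; rewrite !mxE fK.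
  + by move=> a b ab abB; rewrite mxE WB ?(inj_eq finj) // -fB.
- rewrite xE; apply: contra x0 => /eqP/colP E; apply/eqP/colP => i.
  by have := E (g i); rewrite !mxE gK.
- by move=> i ij; rewrite xE mxE xP // -[j]gK -fD.
- move=> v vj vB; rewrite mulE mxE yW //; last by rewrite -[j]gK -fB.
  by apply: contraNneq vj => <-; rewrite fK.
Qed.

(** * The two exceptional graphs *)

Definition node_pairs m (s : seq (nat * nat)) : {set 'I_m * 'I_m} :=
  [set e | (val e.1, val e.2) \in s].

(** The complementary bidirected edges form the path [2 - 0 - 3 - 1] here, and [3 - 0 - 2 - 1] for
    [collider_edges]. *)
Definition chain_edges : {set 'I_4 * 'I_4} :=
  node_pairs 4 [:: (0, 1); (1, 2); (2, 3)]%N.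
Definition collider_edges : {set 'I_4 * 'I_4} :=
  node_pairs 4 [:: (0, 1); (1, 3); (2, 3)]%N.

Lemma chain_edges_irr i : (i, i) \notin chain_edges.
Proof. by rewrite inE; case: i => -[|[|[|[|]]]]. Qed.

Lemma collider_edges_irr i : (i, i) \notin collider_edges.
Proof. by rewrite inE; case: i => -[|[|[|[|]]]]. Qed.

Definition chain_graph := saturation chain_edges_irr.
Definition collider_graph := saturation collider_edges_irr.

Lemma chain_acyclic : acyclic chain_graph.
Proof.
apply: (@acyclic_ranked _ _ val) => i j; rewrite inE.
by case: i => -[|[|[|[|]]]] ? //; case: j => -[|[|[|[|]]]] ? //.
Qed.

Lemma collider_acyclic : acyclic collider_graph.
Proof.
apply: (@acyclic_ranked _ _ val) => i j; rewrite inE.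
by case: i => -[|[|[|[|]]]] ? //; case: j => -[|[|[|[|]]]] ? //.
Qed.

(** In the chain a node has at most one parent, whereas node 3 of the collider graph has the parents
    1 and 2. *)
Lemma chain_collider_nisomorphic : ~ isomorphic chain_graph collider_graph.
Proof.
move=> [f [[g fK gK] fD _]].
pose o k (kP : (k < 4)%N) := Ordinal kP.
have chain_succ a b : (a, b) \in chain_edges -> val b = (val a).+1.
  by rewrite !inE => /or3P[] /eqP[/= -> ->].
have e1 : (g (o 1%N isT), g (o 3%N isT)) \in chain_edges.
  by rewrite [_ \in _]fD !gK inE.
have e2 : (g (o 2%N isT), g (o 3%N isT)) \in chain_edges.
  by rewrite [_ \in _]fD !gK inE.
have := chain_succ _ _ e1; rewrite (chain_succ _ _ e2) => -[].
by move=> /val_inj/(can_inj gK)/(congr1 val).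
Qed.

(** Missing rows and missing trailing entries read as 0. *)
Definition seq_mx (R : realType) m (s : seq (seq R)) : 'M[R]_m :=
  \matrix_(i, j) nth 0 (nth [::] s i) j.

(* Stated with the indices that [big_ord_recl] produces. *)
Lemma cV4_sqr_gt0 (R : realType) (z : 'cV[R]_4) : z != 0 ->
  0 < z ord0 ord0 ^+ 2 + z (lift ord0 ord0) ord0 ^+ 2
    + z (lift ord0 (lift ord0 ord0)) ord0 ^+ 2
    + z (lift ord0 (lift ord0 (lift ord0 ord0))) ord0 ^+ 2.
Proof.
move=> /cV0Pn[i zi].
suff : 0 < \sum_k z k 0 ^+ 2 by rewrite !big_ord_recl big_ord0 addr0 !addrA.
rewrite (bigD1 i) //= ltr_pwDl ?sumr_ge0 // => [|k _]; last exact: sqr_ge0.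
by rewrite lt0r sqr_ge0 sqrf_eq0 zi.
Qed.

Lemma chain_fiber_direction (R : realType) : exists j L W y,
  @fiber_direction R 4 chain_graph j L W y.
Proof.
(* For [j = 3] and [y = (1, 1, 1, 0)], the ones of [L] on [0 -> 1 -> 2] give [(1 - L) y = e_2],
   where 2 is the parent of 3. Moreover [W y = (1, 1, 0, 0)], and 0 and 1 are the bidirected
   neighbors of 3. *)
exists ord_max.
exists (seq_mx 4 [:: [:: 0; 1]; [:: 0; 0; 1]]).
exists (seq_mx 4 [:: [:: 2; 0; -1]; [:: 0; 1]; [:: -1; 0; 1]; [:: 0; 0; 0; 1]]).
exists (\col_i (i != ord_max)%:R); split.
- move=> i j; rewrite inE mxE.
  by case: i => -[|[|[|[|]]]] ? //; case: j => -[|[|[|[|]]]].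
- split; first split.
  + by apply/matrixP => -[[|[|[|[|]]]] ?] // [[|[|[|[|]]]] ?] //; rewrite !mxE.
  + move=> z /cV4_sqr_gt0 z0; rewrite !mxE !big_ord_recl big_ord0 !mxE.
    rewrite !big_ord_recl !big_ord0 !mxE /=.
    (* completing squares in [z^T W z - |z|^2 / 3] *)
    have := sqr_ge0 (z ord0 ord0 - 3 / 5 * z (lift ord0 (lift ord0 ord0)) ord0).
    have := sqr_ge0 (z (lift ord0 (lift ord0 ord0)) ord0).
    nra.
  + move=> i j; rewrite !inE mxE /=.
    by case: i => -[|[|[|[|]]]] ? //; case: j => -[|[|[|[|]]]].
- apply/eqP => /colP/(_ (Ordinal (isT : (2 < 4)%N))).
  by rewrite !mxE !big_ord_recl big_ord0 !mxE /=; lra.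
- move=> i; rewrite !inE /= !mxE !big_ord_recl big_ord0 !mxE /=.
  by case: i => -[|[|[|[|]]]] ? //= _; ring.
- move=> i; rewrite !inE /= !mxE !big_ord_recl big_ord0 !mxE /=.
  by case: i => -[|[|[|[|]]]] ? //= _ _; ring.
Qed.

Lemma collider_fiber_direction (R : realType) : exists j L W y,
  @fiber_direction R 4 collider_graph j L W y.
Proof.
(* Again [y = (1, 1, 1, 0)]. Now [(1 - L) y = e_1 + e_2] lives on the two parents of 3, and
   [W y = e_0] on its only bidirected neighbor. *)
exists ord_max.
exists (seq_mx 4 [:: [:: 0; 1]]).
exists (seq_mx 4
  [:: [:: 2; 0; -1]; [:: 0; 1; -1]; [:: -1; -1; 2]; [:: 0; 0; 0; 1]]).
exists (\col_i (i != ord_max)%:R); split.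
- move=> i j; rewrite inE mxE.
  by case: i => -[|[|[|[|]]]] ? //; case: j => -[|[|[|[|]]]].
- split; first split.
  + by apply/matrixP => -[[|[|[|[|]]]] ?] // [[|[|[|[|]]]] ?] //; rewrite !mxE.
  + move=> z /cV4_sqr_gt0 z0; rewrite !mxE !big_ord_recl big_ord0 !mxE.
    rewrite !big_ord_recl !big_ord0 !mxE /=.
    (* completing squares in [z^T W z - |z|^2 / 8] *)
    have := sqr_ge0
      (z ord0 ord0 - 8 / 15 * z (lift ord0 (lift ord0 ord0)) ord0).
    have := sqr_ge0
      (z (lift ord0 ord0) ord0 - 8 / 7 * z (lift ord0 (lift ord0 ord0)) ord0).
    have := sqr_ge0 (z (lift ord0 (lift ord0 ord0)) ord0).
    nra.
  + move=> i j; rewrite !inE mxE /=.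
    by case: i => -[|[|[|[|]]]] ? //; case: j => -[|[|[|[|]]]].
- apply/eqP => /colP/(_ (Ordinal (isT : (2 < 4)%N))).
  by rewrite !mxE !big_ord_recl big_ord0 !mxE /=; lra.
- move=> i; rewrite !inE /= !mxE !big_ord_recl big_ord0 !mxE /=.
  by case: i => -[|[|[|[|]]]] ? //= _; ring.
- move=> i; rewrite !inE /= !mxE !big_ord_recl big_ord0 !mxE /=.
  by case: i => -[|[|[|[|]]]] ? //= _ _; ring.
Qed.

(** * Classification on at most four nodes *)

(** The isomorphism is read off from the enumeration [p] of the nodes, and finitely many edge tests
    remain; by symmetry, bidirected pairs are tested in increasing order only. *)
Lemma isomorphic_saturation4 (G : mixed_graph 4) (s : seq (nat * nat))
    (irr : forall i, (i, i) \notin node_pairs 4 s) (p : seq 'I_4) (j : 'I_4) :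
  acyclic G -> simple G -> uniq p -> size p = 4%N ->
  all (fun e => (nth j p e.1, nth j p e.2) \in directed G) s ->
  all (fun e => (nth j p e.1, nth j p e.2) \in bidirected G)
    [seq e <- [:: (0, 1); (0, 2); (0, 3); (1, 2); (1, 3); (2, 3)]%N
       | (e \notin s) && ((e.2, e.1) \notin s)] ->
  isomorphic G (saturation irr).
Proof.
move=> acG sG up sp /allP sD /allP sB.
apply: (@isomorphic_saturation _ _ _ _ (fun i => nth j p i)) => //.
- by move=> a b /eqP; rewrite nth_uniq ?sp // => /eqP/val_inj.
- by move=> a b; rewrite inE => /sD.
move=> a b; wlog ab : a b / (a < b)%N => [th|_].
  move=> aNb abD baD; case: (ltngtP a b) => [ab|ba|/val_inj/eqP].
  - exact: th.
  - by rewrite bidirected_sym; apply: th => //; rewrite eq_sym.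
  - by rewrite (negPf aNb).
rewrite !inE => abs bas; apply: (sB (val a, val b)).
rewrite mem_filter abs bas /= {sB abs bas}.
by move: ab; case: a => -[|[|[|[|]]]] ? //; case: b => -[|[|[|[|]]]].
Qed.

(* The elements of [s] are sorted by rank, hence the last one can only point to
   [j], and few cases are left for the outgoing edges of the others. *)
Lemma converging_connected_4 (T : eqType) (d b : rel T) (rank : T -> nat)
    (j : T) (s : seq T) :
  (forall x y, d x y -> (rank x < rank y)%N) ->
  (forall x y, d x y -> ~~ b x y) -> symmetric b -> (forall x, ~~ b x x) ->
  uniq (j :: s) -> s != [::] -> (size s <= 3)%N ->
  sorted (fun x y => (rank x <= rank y)%N) s ->
  all (fun x => has (d x) (j :: s)) s ->
  (forall sel, let K := mask sel s in K != [::] ->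
     has (fun x => has (fun y => (y \notin K) && b x y) (j :: s)) K) ->
  exists p : seq T, [/\ uniq p, size p = 4%N &
    let D e := d (nth j p e.1) (nth j p e.2) in
    let B e := b (nth j p e.1) (nth j p e.2) in
    all D [:: (0, 1); (1, 2); (2, 3)]%N &&
      all B [:: (0, 2); (0, 3); (1, 3)]%N \/
    all D [:: (0, 1); (1, 3); (2, 3)]%N &&
      all B [:: (0, 2); (0, 3); (1, 2)]%N].
Proof.
move=> rk db bC bxx us s0 sz srt out conn.
have dlt x y : (rank x <= rank y)%N -> d y x = false.
  by move=> xy; apply/negP => /rk; rewrite ltnNge xy.
have dxx x : d x x = false by rewrite dlt.
have {}bxx x : b x x = false by exact: negbTE.
have {}db x y : d x y && b x y = false by apply/negP => /andP[/db/negP].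
case: s us s0 sz srt out conn =>
  [|x1 [|x2 [|x3 [|? s]]]] //= us _ _ srt out conn.
(* The single pair [x1], [j] would have to carry both kinds of edge. *)
- move: us; rewrite !inE andbT => jx1.
  move: out (db x1 j) (conn [:: true] isT).
  rewrite /= !inE !eqxx dxx /=.
  by rewrite (negPf jx1) /= ?andbT ?orbF; case: (d x1 j); case: (b x1 j).
(* Here [x2] must point to [j]. Connectivity of the subset [x2] then forces [x1 <-> x2], that of
   [x1], [x2] forces [x1 <-> j], and no pair is left for a directed edge out of [x1]. *)
- move: us; rewrite !inE !negb_or => /and3P[/andP[jx1 jx2] x12 _].
  move: srt; rewrite andbT => le12.
  move: out (db x1 j) (db x1 x2) (db x2 j).
  move: (conn [:: false; true] isT) (conn [:: true; true] isT).
  rewrite /= !inE !eqxx !orbT !dxx !bxx (dlt x1 x2) // (bC x2 x1) /=.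
  rewrite (negPf jx1) (negPf jx2) (negPf x12) /= ?andbF ?andbT ?orbF /=.
  by case: (d x1 j); case: (d x1 x2); case: (d x2 j);
    case: (b x1 j); case: (b x1 x2); case: (b x2 j).
- move: us; rewrite !inE !negb_or.
  move=> /and4P[/and3P[jx1 jx2 jx3] /andP[x12 x13] x23 _].
  move: srt; rewrite andbT => /andP[le12 le23].
  have le13 := leq_trans le12 le23.
  have x21 : (x2 == x1) = false by rewrite eq_sym (negPf x12).
  have x31 : (x3 == x1) = false by rewrite eq_sym (negPf x13).
  have x32 : (x3 == x2) = false by rewrite eq_sym (negPf x23).
  move: out (db x1 j) (db x1 x2) (db x2 j) (db x3 j) (db x1 x3) (db x2 x3).
  (* The masks run over the seven nonempty subsets of [x1], [x2], [x3]. *)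
  move: (conn [:: true] isT) (conn [:: false; true] isT).
  move: (conn [:: false; false; true] isT) (conn [:: true; true] isT).
  move: (conn [:: true; false; true] isT) (conn [:: false; true; true] isT).
  move: (conn [:: true; true; true] isT).
  rewrite /= !inE !eqxx !orbT !dxx !bxx /=.
  rewrite (dlt x1 x2) // (dlt x2 x3) // (dlt x1 x3) //.
  rewrite (bC x2 x1) (bC x3 x1) (bC x3 x2).
  rewrite (negPf jx1) (negPf jx2) (negPf jx3).
  rewrite (negPf x12) (negPf x13) (negPf x23) x21 x31 x32 ?andbF ?andbT ?orbF /=.
  have us p : perm_eq p [:: x1; x2; x3; j] -> uniq p.
    move/perm_uniq=> ->; rewrite /= !inE !negb_or x12 x13 x23.
    by rewrite ![_ == j]eq_sym jx1 jx2 jx3.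
  move=> c1 c2 c3 c4 c5 c6 c7 o e1 e2 e3 e4 e5 e6.
  (* First the chain, then the collider with [x1], [x3] or [x2] in the role of node 2, the source
     pointing straight to [j]. *)
  have : [|| [&& d x1 x2, d x2 x3, d x3 j, b x1 x3, b x1 j & b x2 j],
      [&& d x2 x3, d x3 j, d x1 j, b x1 x2, b x2 j & b x1 x3],
      [&& d x1 x2, d x2 j, d x3 j, b x1 x3, b x1 j & b x2 x3] |
      [&& d x1 x3, d x3 j, d x2 j, b x1 x2, b x1 j & b x2 x3]].
  { move: o e1 e2 e3 e4 e5 e6 c1 c2 c3 c4 c5 c6 c7 {conn}.
    case: (d x3 j); case: (b x3 j) => //=; rewrite ?andbF //.
    case: (d x1 j); case: (b x1 j) => //=; rewrite ?andbF //.
    all: case: (d x2 j); case: (b x2 j) => //=; rewrite ?andbF //.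
    all: case: (d x2 x3); case: (b x2 x3) => //=; rewrite ?andbF //.
    all: case: (d x1 x2); case: (b x1 x2) => //=; rewrite ?andbF //.
    all: by case: (d x1 x3); case: (b x1 x3). }
  case/or4P => /and5P[D1 D2 D3 B1 /andP[B2 B3]].
  - exists [:: x1; x2; x3; j]; split=> //; first exact: us.
    by left; rewrite /= D1 D2 D3 B1 B2 B3.
  - exists [:: x2; x3; x1; j]; split=> //; first apply: us.
      by rewrite (perm_catCA [:: x2; x3] [:: x1]).
    by right; rewrite /= D1 D2 D3 (bC x2 x1) (bC x3 x1) B1 B2 B3.
  - exists [:: x1; x2; x3; j]; split=> //; first exact: us.
    by right; rewrite /= D1 D2 D3 B1 B2 B3.
  - exists [:: x1; x3; x2; j]; split=> //; first apply: us.
      by rewrite perm_cons (perm_catCA [:: x3] [:: x2]).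
    by right; rewrite /= D1 D2 D3 (bC x3 x2) B1 B2 B3.
Qed.

(** On a doubled edge, [lambda_ij] can be traded against [omega_ij]: [(1 - L) y] and [W y] both
    equal [e_i], and [i] is at once a parent and a bidirected neighbor of [j]. *)
Lemma edge_pair_fiber_direction (R : realType) m (G : mixed_graph m) i j :
  (i, j) \in directed G -> (i, j) \in bidirected G ->
  fiber_direction G j 0 1%:M (delta_mx i 0 : 'cV[R]_m).
Proof.
move=> ijD ijB; rewrite /fiber_direction subr0 mul1mx; split.
- by move=> a b _; rewrite mxE.
- split=> [|a b ab _]; last by rewrite mxE (negPf ab).
  split=> [|z /cV0Pn[k zk]]; first exact: trmx1.
  rewrite mulmx1 mxE (bigD1 k) //= ltr_pwDl ?sumr_ge0 // => [|l _].
    by rewrite mxE -expr2 lt0r sqr_ge0 sqrf_eq0 zk.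
  by rewrite mxE -expr2 sqr_ge0.
- by apply/cV0Pn; exists i; rewrite mxE !eqxx oner_eq0.
- by move=> k kj; rewrite mxE; case: eqVneq kj => // ->; rewrite ijD.
- by move=> v _ vj; rewrite mxE; case: eqVneq vj => // ->; rewrite ijB.
Qed.

(** This serves both halves of the theorem: four distinct nodes are absurd for [m <= 3], and for
    [m = 4] they enumerate the graph and identify it. *)
Lemma simple_not_inj_4 (R : realType) m (G : mixed_graph m) :
  (m <= 4)%N -> acyclic G -> simple G ->
  ~ set_inj (Theta R G) (@phi R m) ->
  exists (p : seq 'I_m) (j : 'I_m), [/\ uniq p, size p = 4%N &
    let D e := (nth j p e.1, nth j p e.2) \in directed G in
    let B e := (nth j p e.1, nth j p e.2) \in bidirected G in
    all D [:: (0, 1); (1, 2); (2, 3)]%N &&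
      all B [:: (0, 2); (0, 3); (1, 3)]%N \/
    all D [:: (0, 1); (1, 3); (2, 3)]%N &&
      all B [:: (0, 2); (0, 3); (1, 2)]%N].
Proof.
move=> m4 acG sG ninj.
have [rank rkP] := acyclic_rank acG.
have [j [Y [Y0 jY out conn]]] := not_inj_converging_connected acG ninj.
pose s := sort (fun x y => (rank x <= rank y)%N) (enum Y).
have sY x : (x \in s) = (x \in Y) by rewrite mem_sort mem_enum.
have us : uniq (j :: s) by rewrite /= sY jY sort_uniq enum_uniq.
have [||||||||p [up sp pP]] :=
  @converging_connected_4 _ (dedge G) (fun x y => (x, y) \in bidirected G)
    rank j s rkP _ _ _ us; last by exists p, j.
- by move=> x y; exact: simple_disjoint.
- by move=> x y; exact: bidirected_sym.
- exact: bidirected_irr.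
- have /set0Pn[i] := Y0; rewrite -sY => is_; apply: contraTneq is_ => ->.
  by rewrite in_nil.
(* The node [j] takes one of the at most four places, which leaves three for [s]. *)
- rewrite -ltnS (leq_trans _ m4) // -[(size s).+1]/(size (j :: s)).
  by rewrite -(card_uniqP us) (leq_trans (max_card _)) ?card_ord.
- by apply: sort_sorted => x y; exact: leq_total.
- apply/allP => x; rewrite sY => /out[y yY xy]; apply/hasP; exists y => //.
  by rewrite inE sY -in_setU1.
- move=> sel K K0; have Ks x : x \in K -> x \in s by exact: mem_mask.
  have [||x [y [xK yY yK xy]]] := conn [set x in K].
  + by case: K K0 {Ks} => // x K _; apply/set0Pn; exists x; rewrite !inE eqxx.
  + by apply/fintype.subsetP => x; rewrite inE => /Ks; rewrite sY.
  rewrite !inE in xK yK; apply/hasP; exists x => //.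
  by apply/hasP; exists y; rewrite ?yK // inE sY -in_setU1.
Qed.

Theorem corollary1 (R : realType) :
  (forall (m : nat) (G : mixed_graph m), (m <= 3)%N -> acyclic G ->
     (set_inj (Theta R G) (@phi R m) <-> simple G)) /\
  (exists G1 G2 : mixed_graph 4,
     ~ isomorphic G1 G2 /\
     forall G : mixed_graph 4,
       (acyclic G /\ simple G /\ ~ set_inj (Theta R G) (@phi R 4)) <->
       (isomorphic G G1 \/ isomorphic G G2)).
Proof.
split.
  move=> m G m3 acG; split=> [inj|sG]; apply: contrapT.
    move=> /eqP/set0Pn[[i j]]; rewrite inE => /andP[ijD ijB].
    exact: (fiber_direction_not_inj acG (edge_pair_fiber_direction R ijD ijB)).
  move=> /(simple_not_inj_4 (leqW m3) acG sG)[p [_ [up sp _]]].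
  have := max_card (mem p); rewrite (card_uniqP up) sp card_ord => m4.
  by have := leq_trans m4 m3.
exists chain_graph, collider_graph; split.
  exact: chain_collider_nisomorphic.
move=> G; split=> [[acG [sG ninj]]|].
  have [p [j [up sp pP]]] := simple_not_inj_4 (leqnn 4) acG sG ninj.
  case: pP => /andP[pD pB]; [left|right].
  - apply: (isomorphic_saturation4 _ acG sG up sp pD); exact: pB.
  - apply: (isomorphic_saturation4 _ acG sG up sp pD); exact: pB.
case=> iso; (split; [|split]).
- exact: acyclic_isomorphic iso chain_acyclic.
- exact: simple_isomorphic iso (saturation_simple _).
- have [j [L [W [y yP]]]] := chain_fiber_direction R.
  have [j' [L' [W' [y' y'P]]]] := fiber_direction_isomorphic iso yP.
  apply: fiber_direction_not_inj y'P.
  exact: acyclic_isomorphic iso chain_acyclic.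
- exact: acyclic_isomorphic iso collider_acyclic.
- exact: simple_isomorphic iso (saturation_simple _).
- have [j [L [W [y yP]]]] := collider_fiber_direction R.
  have [j' [L' [W' [y' y'P]]]] := fiber_direction_isomorphic iso yP.
  apply: fiber_direction_not_inj y'P.
  exact: acyclic_isomorphic iso collider_acyclic.
Qed.
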